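(* Let $m,n$ be relatively prime integers with $1\le m<n$, and suppose that either $n\le 11$, or $n=2^r$ for some integer $r>0$, or $n=2p$ for some odd prime $p$. Let $y=e^{2\pi i m/n}$. Then any complex algebraic quadratic cyclic sequence with turning angle $2\pi m/n$ must use all increments $\{y^0,y^1,\ldots,y^{n-1}\}$. Furthermore, if in addition $n$ is even, then for each occurrence of the increment $y^k$ there is also an occurrence of the increment $y^{\frac n2+k}=-y^k$ (i.e. $y^k$ and $-y^k$ occur the same number of times). In particular, the corresponding closed polygonal walk in the plane contains each edge with its oppositely orientated counterpart.
   Context: A *quadratic cyclic sequence (QCS) of order $N\ge2$* is a function $\phi:\mathbb{Z}/N\mathbb{Z}\to\mathbb{C}$ such that for some real constant $\gamma$, for all $j\in\mathbb{Z}/N\mathbb{Z}$, $\frac{\gamma}{2}(2\phi(j)-\phi(j-1)-\phi(j+1))^2=(\phi(j)-\phi(j-1))^2+(\phi(j)-\phi(j+1))^2$. A *complex algebraic QCS with turning angle $\theta=2\pi m/n$* is a QCS whose increments $u_j=\phi(j+1)-\phi(j)$ are, up to multiplication of $\phi$ by a nonzero constant, of the form $u_j=y^{s_j}$ with $y=e^{2\pi i m/n}$, $s_j\in\mathbb{Z}/n\mathbb{Z}$ and $s_{j+1}= s_j\pm1$ in $\mathbb{Z}/n\mathbb{Z}$ for all $j\in\mathbb{Z}/N\mathbb{Z}$ (cyclically). The corresponding polygonal walk is the closed polygon with directed edges from $\phi(j)$ to $\phi(j+1)$; at each vertex it turns by $+\theta$ or $-\theta$. The increment $y^k$ is used, or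 occurs, at $j$ when $s_j=k$. *)

(* Defs.v *)
(* MathComp and MathComp-Analysis; the complex numbers are R[i], R : realType. *)
From HB Require Import structures.
From mathcomp Require Import all_boot all_order all_algebra.
From mathcomp Require Import reals trigo.
From mathcomp Require Import complex.

Set Implicit Arguments.
Unset Strict Implicit.
Unset Printing Implicit Defensive.

Import Order.TTheory GRing.Theory Num.Theory.
Local Open Scope ring_scope.
Local Open Scope complex_scope.

Definition expi (R : realType) (t : R) : R[i] := cos t +i* sin t.

(* y = e^(2 pi i m / n) *)
Definition turn (R : realType) (m n : nat) : R[i] :=
  expi (2 * pi * m%:R / n%:R).

(* Here and below 'Z_N and 'Z_n stand for Z/NZ and Z/nZ; this is only the case
   for N, n >= 2, which has to be assumed separately. *)
Definition is_qcs (R : realType) (N : nat) (phi : 'Z_N -> R[i]) : Prop :=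
  exists gamma : R, forall j : 'Z_N,
    (gamma / 2)%:C * (2 * phi j - phi (j - 1) - phi (j + 1)) ^+ 2
    = (phi j - phi (j - 1)) ^+ 2 + (phi j - phi (j + 1)) ^+ 2.

Definition increment (R : realType) (N : nat) (phi : 'Z_N -> R[i])
  (j : 'Z_N) : R[i] := phi (j + 1) - phi j.

(* phi is a complex algebraic quadratic cyclic sequence with turning angle
   2 pi m / n whose increments, after rescaling phi, are the y ^ (s j).
   The exponent s j is read as its representative in {0, ..., n-1}. *)
Definition is_algebraic_qcs (R : realType) (m n N : nat)
    (phi : 'Z_N -> R[i]) (s : 'Z_N -> 'Z_n) : Prop :=
  [/\ is_qcs phi,
      exists2 c : R[i], c != 0 &
        forall j, increment (fun i => c * phi i) j = turn R m n ^+ (s j)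
    & forall j, s (j + 1) = s j + 1 \/ s (j + 1) = s j - 1].

Definition occurrences (n N : nat) (s : 'Z_N -> 'Z_n) (k : 'Z_n) : {set 'Z_N} :=
  [set j | s j == k].

(* Every directed edge phi j -> phi (j + 1) of the closed walk is matched,
   bijectively, with an edge of the walk pointing in the opposite direction and
   of the same length; edges are compared as free vectors, since e.g. the
   opposite sides of a regular hexagon are only parallel. *)
Definition edges_paired_with_opposites (R : realType) (N : nat)
    (phi : 'Z_N -> R[i]) : Prop :=
  exists2 tau : 'Z_N -> 'Z_N, involutive tau &
    forall j, increment phi (tau j) = - increment phi j.

(* Main.v *)
Require Import Defs.
From mathcomp Require Import all_boot all_order all_algebra.
From mathcomp Require Import algC cyclotomic.
From mathcomp Require Import reals trigo.
From mathcomp Require Import complex.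
From mathcomp Require Import ring lra zify.

Set Implicit Arguments.
Unset Strict Implicit.
Unset Printing Implicit Defensive.

Import Order.TTheory GRing.Theory Num.Theory.
Local Open Scope ring_scope.
Local Open Scope complex_scope.

(** Let [a k] be the number of times the increment [y ^+ k] occurs.  The walk is
    closed, so [\sum_k a k * y ^+ k = 0].  Everything follows from one fact: for
    some [d] with [0 < d < n], equal to [n / 2] when [n] is even, the counts [a]
    are invariant under the shift by [d].

    Invariance.  By Fourier inversion on Z/n it suffices that at each [n]-th root
    of unity [z], either [z ^+ d = 1] or [\sum_k a k * z ^+ k = 0].  At the
    primitive [z] the sum vanishes, since the cyclotomic polynomial is irreducible
    over the rationals and the [a k] are integers ([sum_walk_conj]).  Every [n] of
    the theorem is a power of a prime [p] or twice a prime [p].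
    - If [n] is a power of [p], the other [z] have [z ^+ (n / p) = 1], so
      [d = n / p].
    - If [n = 2 p], take [d = p]: a [z] that is neither primitive nor a [p]-th
      root of unity is [-1].  As [s] changes parity at each step and the walk is
      cyclic, the sum at [-1] vanishes as well ([sum_walk_N1]).

    All increments occur.  If some are missed, choose a missed [k] such that
    [k + 1] occurs.  Then [k + d] is missed too, and a walk with steps [1] and
    [-1] cannot leave the arc between [k] and [k + d]
    ([cyclic_walk_confined]); but [k + 1 + d] is outside this arc, and it occurs
    because [k + 1] does.

    For even [n], invariance under [n / 2] is the equality of the numbers of
    occurrences of [y ^+ k] and [- y ^+ k], and the two sets of occurrences can be
    matched in increasing order. *)

(** * Vanishing at conjugate roots of unity *)

(** [z] is a root of some cyclotomic factor ['Phi_d] of ['X^n - 1], hence a [d]-th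
    root of unity, and primitivity forces [d = n]. *)
Lemma root_Cyclotomic (F : numFieldType) (n : nat) (z : F) :
  n.-primitive_root z -> root (map_poly intr 'Phi_n) z.
Proof.
move=> prim_z; have n_gt0 := prim_order_gt0 prim_z.
pose q d : {poly F} := map_poly intr 'Phi_d.
have prod_q e : (0 < e)%N -> \prod_(d <- divisors e) q d = 'X^e - 1.
  move=> e_gt0; rewrite -rmorph_prod prod_Cyclotomic // rmorphB /= rmorph1.
  by rewrite map_polyXn.
have : root (\prod_(d <- divisors n) q d) z.
  by rewrite prod_q // rootE !hornerE prim_expr_order // subrr.
rewrite /root horner_prod prodf_seq_eq0 => /hasP[d d_n /= qz0].
have dv_dn : (d %| n)%N by rewrite dvdn_divisors.
have d_gt0 := dvdn_gt0 n_gt0 dv_dn.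
suff /eqP <- : d == n by [].
rewrite eqn_dvd dv_dn (prim_order_dvd prim_z) -subr_eq0.
have /(congr1 (horner^~ z)) := prod_q _ d_gt0.
rewrite !hornerE (big_rem d) /= ?hornerM ?(eqP qz0) ?mul0r.
  by move=> <-.
by rewrite -dvdn_divisors.
Qed.

(** Primitive [n]-th roots of unity are conjugate over the rationals.  In [F] this
    comes from the irreducibility of ['Phi_n], which is obtained by recognizing
    ['Phi_n] as the minimal polynomial of an algebraic number [w]. *)
Lemma root_prim_root_conj (F : numFieldType) (n : nat) (y z : F)
    (P : {poly rat}) :
  n.-primitive_root y -> n.-primitive_root z ->
  root (map_poly ratr P) y -> root (map_poly ratr P) z.
Proof.
move=> prim_y prim_z Py0; have n_gt0 := prim_order_gt0 prim_y.
have [w prim_w] := C_prim_root_exists n_gt0.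
have [p [Dp mon_p] irr_p] := minCpolyP w.
have Dphi : p = map_poly intr 'Phi_n.
  apply: (map_inj_poly (fmorph_inj (ratr : rat -> algC)) (rmorph0 _)).
  rewrite -Dp (minCpoly_cyclotomic prim_w) -(Cintr_Cyclotomic prim_w).
  rewrite -map_poly_comp.
  by apply: eq_map_poly => x /=; rewrite ratr_int.
have root_p (x : F) : n.-primitive_root x -> root (map_poly ratr p) x.
  move=> /root_Cyclotomic; rewrite Dphi -map_poly_comp.
  by congr (root _ x); apply: eq_map_poly => c /=; rewrite ratr_int.
have p_neq0 := monic_neq0 mon_p.
(* Either Bezout contradicts the common root [y], or irreducibility of [p]
   yields that [p] divides [P]. *)
have [cop | ncop] := boolP (coprimep p P).
  have : coprimep (map_poly (ratr : rat -> F) p) (map_poly ratr P).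
    by rewrite coprimep_map.
  by move/coprimep_root/(_ (root_p y prim_y)); rewrite (rootP Py0) eqxx.
suff /dvdpP[q ->] : p %| P.
  by rewrite rmorphM rootM root_p ?orbT.
have /dvdpP[h Dh] := dvdp_gcdl p P.
have : root (map_poly ratr p) w by rewrite irr_p.
rewrite {1}Dh rmorphM rootM !irr_p => /orP[p_h|p_g]; last first.
  exact: dvdp_trans p_g (dvdp_gcdr _ _).
case/negP: ncop; rewrite /coprimep.
have : h * gcdp p P %| h * 1 by rewrite -Dh mulr1.
rewrite dvdp_mul2l ?dvdp1 //.
by apply: contraNneq p_neq0 => h0; rewrite Dh h0 mul0r.
Qed.

(** * Fourier analysis on Z/n *)

Lemma ltn_Zp (n : nat) (k : 'Z_n) : (1 < n)%N -> (k < n)%N.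
Proof. by case: n k => [|[|n]]. Qed.

Lemma val_Zp_add (n : nat) (k l : 'Z_n) :
  (1 < n)%N -> (k + l)%R = ((k + l) %% n)%N :> nat.
Proof. by case: n k l => [|[|n]]. Qed.

Lemma expr_Zp_add (A : pzSemiRingType) (n : nat) (z : A) (k l : 'Z_n) :
  (1 < n)%N -> z ^+ n = 1 -> z ^+ (k + l)%R = z ^+ k * z ^+ l.
Proof. by move=> n_gt1 zn1; rewrite val_Zp_add // expr_mod // exprD. Qed.

(** The hypothesis says that the Fourier transform of [a k - a (k + d)], which is
    [(1 - z ^- d)] times that of [a], vanishes at every character
    [k |-> z ^+ k].  It is read as a polynomial of degree less than [n] having
    the [n] roots [y ^+ i]. *)
Lemma shift_invariant_of_DFT (F : fieldType) (n d : nat) (y : F)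
    (a : 'Z_n -> F) :
  (1 < n)%N -> n.-primitive_root y ->
  (forall i, (y ^+ i) ^+ d = 1 \/ \sum_k a k * (y ^+ i) ^+ k = 0) ->
  forall k, a (k + d%:R) = a k.
Proof.
move=> n_gt1 prim_y ker_y.
pose b k := a k - a (k + d%:R).
suff b0 k : b k = 0 by move=> k; apply/eqP; rewrite eq_sym -subr_eq0 -/(b k) b0.
pose T := \poly_(l < n) b (l%:R).
have T_root i : root T (y ^+ i).
  set z := y ^+ i.
  have zn1 : z ^+ n = 1 by rewrite /z exprAC (prim_expr_order prim_y) expr1n.
  have -> : root T z = (\sum_k b k * z ^+ k == 0).
    rewrite rootE horner_poly -(big_mkord xpredT (fun l => b l%:R * z ^+ l)).
    rewrite -[X in index_iota _ X](Zp_cast n_gt1) big_mkord.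
    by congr (_ == 0); apply: eq_bigr => l _; rewrite natr_Zp.
  have shift : \sum_k a k * z ^+ k = z ^+ d * \sum_k a (k + d%:R) * z ^+ k.
    rewrite (reindex_inj (addIr (d%:R : 'Z_n))) mulr_sumr; apply: eq_bigr => l _.
    rewrite expr_Zp_add // val_Zp_nat // expr_mod //.
    by rewrite [RHS]mulrCA [z ^+ d * _]mulrC.
  have -> : \sum_k b k * z ^+ k =
      \sum_k a k * z ^+ k - \sum_k a (k + d%:R) * z ^+ k.
    by rewrite -sumrB; apply: eq_bigr => l _; rewrite mulrBl.
  have := ker_y i; rewrite -/z => -[zd1|az0].
    by rewrite shift zd1 mul1r subrr.
  have z_neq0 : z != 0.
    by apply: contraTneq n_gt1 => z0; move/eqP: zn1; rewrite z0 expr0n;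
       case: (n) => [|n'] //=; rewrite eq_sym oner_eq0.
  move/eqP: shift; rewrite az0 eq_sym mulf_eq0 expf_eq0 (negbTE z_neq0) andbF /=.
  by move=> /eqP ->; rewrite subr0.
have T0 : T = 0.
  apply: (@roots_geq_poly_eq0 _ _ [seq y ^+ i | i <- iota 0 n]).
  - by apply/allP => _ /mapP[i _ ->].
  - rewrite map_inj_in_uniq ?iota_uniq // => i j; rewrite !mem_iota !add0n /=.
    move=> i_lt j_lt /eqP; rewrite (eq_prim_root_expr prim_y).
    by rewrite !modn_small // => /eqP.
  - by rewrite size_map size_iota size_poly.
have k_lt : (k < n)%N by apply: ltn_Zp.
have /(congr1 (fun q : {poly F} => q`_k)) := T0.
by rewrite coef_poly k_lt coef0 natr_Zp.
Qed.

(** * The turning factor is a primitive root of unity *)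

Lemma expiD (R : realType) (a b : R) : expi (a + b) = expi a * expi b.
Proof. by rewrite /expi cosD sinD; simpc; rewrite [sin a * _ + _]addrC. Qed.

Lemma expiMn (R : realType) (a : R) (k : nat) : expi (a *+ k) = expi a ^+ k.
Proof.
elim: k => [|k IHk]; first by rewrite mulr0n /expi cos0 sin0.
by rewrite mulrS expiD IHk exprS.
Qed.

(** The half angle avoids any discussion of signs: [cos (2 a) = 1 - 2 sin a ^ 2],
    and [sin] is positive on the open interval from [0] to [pi]. *)
Lemma expi_neq1 (R : realType) (a : R) : 0 < a < pi -> expi (a *+ 2) != 1.
Proof.
move=> /sin_gt0_pi sin_gt0; apply/eqP => -[]; rewrite cos_mulr2n => cos1 _.
have := cos2Dsin2 a; have := exprn_gt0 2 sin_gt0; lra.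
Qed.

Lemma turn_prim_root (R : realType) (m n : nat) :
  (0 < n)%N -> coprime m n -> n.-primitive_root (turn R m n).
Proof.
move=> n_gt0 co_mn; have n_neq0 : n%:R != 0 :> R by rewrite pnatr_eq0 -lt0n.
have -> : turn R m n = turn R 1 n ^+ m.
  by rewrite /turn -expiMn; congr expi; field.
suff prim1 : n.-primitive_root (turn R 1 n) by rewrite prim_root_exp_coprime.
have turnX k : turn R 1 n ^+ k = expi ((pi * (k%:R / n%:R)) *+ 2).
  by rewrite /turn -expiMn; congr expi; field.
have turnXn : turn R 1 n ^+ n = 1.
  by rewrite turnX divff // mulr1 /expi cos2pi sin2pi.
have [e prim_e e_n] := prim_order_exists n_gt0 turnXn.
have [e_lt|n_le] := ltnP e n; last first.
  by move: prim_e; have /eqP -> : e == n by rewrite eqn_leq n_le dvdn_leq.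
have := prim_expr_order prim_e; rewrite turnX => /eqP; apply: contraLR => _.
have e_gt0 := prim_order_gt0 prim_e.
apply: expi_neq1; rewrite mulr_gt0 ?pi_gt0 ?divr_gt0 ?ltr0n //=.
by rewrite gtr_pMr ?pi_gt0 // ltr_pdivrMr ?ltr0n // mul1r ltr_nat.
Qed.

(** * Walks on a cycle *)

Definition cyclic_walk (N n : nat) (s : 'Z_N -> 'Z_n) : Prop :=
  forall j, s (j + 1) = s j + 1 \/ s (j + 1) = s j - 1.

Lemma cyclic_ind (N : nat) (P : 'Z_N -> Prop) (j0 : 'Z_N) :
  P j0 -> (forall j, P j -> P (j + 1)) -> forall j, P j.
Proof.
move=> P0 PS j; rewrite -[j](subrK j0) -[j - j0]natr_Zp.
elim: (val (j - j0)) => [|t IHt]; first by rewrite add0r.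
by rewrite -natr1 addrAC; apply: PS.
Qed.

(** Seen from [k], the walk starts at [1]; it can neither wrap around through [0]
    nor pass [d], both of which it avoids. *)
Lemma cyclic_walk_confined (N n d : nat) (s : 'Z_N -> 'Z_n) (k : 'Z_n)
    (j0 : 'Z_N) :
  (1 < n)%N -> (0 < d < n)%N -> cyclic_walk s ->
  (forall j, s j != k) -> (forall j, s j != k + d%:R) ->
  s j0 = k + 1 -> forall j, (0 < (s j - k)%R < d)%N.
Proof.
move=> n_gt1 /andP[d_gt0 d_lt] walk_s no_k no_kd sj0.
have val1 : (1%R : 'Z_n) = 1%N :> nat by rewrite (val_Zp_nat n_gt1 1) modn_small.
have val_d : (d%:R : 'Z_n) = d :> nat by rewrite val_Zp_nat // modn_small.
have gt0 j : (0 < (s j - k)%R)%N.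
  rewrite lt0n; apply: contra (no_k j) => /eqP sk0.
  by rewrite -subr_eq0; apply/eqP/val_inj.
have neq_d j : (s j - k)%R != d :> nat.
  apply: contra (no_kd j) => /eqP skd; rewrite -(subrK k (s j)) addrC.
  by apply/eqP; congr (_ + _); apply: val_inj; rewrite [LHS]skd [RHS]val_d.
suff lt_d j : ((s j - k)%R < d)%N by move=> j; rewrite gt0 lt_d.
  move: j; apply: (@cyclic_ind N (fun j => ((s j - k)%R < d)%N) j0) => [|j IHj].
  have := neq_d j0; rewrite sj0 addrC addKr val1; lia.
case: (walk_s j) (neq_d (j + 1)) => sj1 => [neq|_].
  move: neq; rewrite sj1 addrAC val_Zp_add // val1.
  move: IHj; set x := nat_of_ord (s j - k) => x_lt; rewrite modn_small; lia.
have : (s j - k)%R = (s (j + 1) - k + 1)%R by rewrite sj1; ring.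
move/(congr1 (@nat_of_ord _)); rewrite [RHS]val_Zp_add // val1 => sjE.
(* A step back to [n - 1] would start from [0]. *)
have [sn|sn] := ltnP ((s (j + 1) - k)%R + 1) n.
  by rewrite modn_small // in sjE; move: IHj; rewrite sjE; lia.
have lt_n : ((s (j + 1) - k)%R < n)%N by apply: ltn_Zp.
have eqn : ((s (j + 1) - k)%R + 1 = n)%N by lia.
by have := gt0 j; rewrite sjE eqn modnn.
Qed.

(** Since the set of values taken by the walk is stable under translation by [d],
    confinement to an arc of length [d] rules out that [k + 1] is a value and [k]
    is not; so the set of values is stable under predecessor. *)
Lemma cyclic_walk_surj (N n d : nat) (s : 'Z_N -> 'Z_n) :
  (1 < n)%N -> (0 < d < n)%N -> cyclic_walk s ->
  (forall k, #|occurrences s (k + d%:R)| = #|occurrences s k|) ->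
  forall k, exists j, s j = k.
Proof.
move=> n_gt1 d_bd walk_s period.
pose hit k := occurrences s k != set0.
have hitP k : reflect (exists j, s j = k) (hit k).
  rewrite /hit; apply: (iffP (set0Pn _)) => -[j sj]; exists j.
    by move: sj; rewrite inE => /eqP.
  by rewrite inE sj.
have hit_d k : hit (k + d%:R) = hit k by rewrite /hit -!card_gt0 period.
have hit_pred k : hit (k + 1) -> hit k.
  move=> hit1; apply: contraT => miss_k.
  have missE l : ~~ hit l -> forall j, s j != l.
    by move=> /hitP miss j; apply/eqP => sj; case: miss; exists j.
  have miss_kd : ~~ hit (k + d%:R) by rewrite hit_d.
  have /hitP[j0 sj0] := hit1.
  have conf := cyclic_walk_confined n_gt1 d_bd walk_s (missE _ miss_k)
    (missE _ miss_kd) sj0.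
  have /hitP[j1 sj1] : hit (k + 1 + d%:R) by rewrite hit_d.
  have /andP[d_gt0 d_lt] := d_bd.
  (* The offset [d + 1] of [s j1] from [k] exceeds [d], or wraps to [0] when
     [d + 1 = n]; both are outside the arc. *)
  have := conf j1; rewrite sj1.
  have -> : k + 1 + d%:R - k = d.+1%:R by rewrite -natr1; ring.
  rewrite val_Zp_nat //; have [dn|dn] := ltnP d.+1 n.
    by rewrite modn_small //; lia.
  by have -> : d.+1 = n by [lia]; rewrite modnn.
move=> k; apply/hitP.
have: hit (s 0) by apply/hitP; exists 0.
rewrite -(subrK k (s 0)) -[s 0 - k]natr_Zp.
elim: (val _) => [|t IHt]; first by rewrite add0r.
by rewrite -natr1 addrAC => /hit_pred.
Qed.

(** * Exponential sums along a walk *)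

Lemma sum_walk_conj (F : numFieldType) (N n : nat) (s : 'Z_N -> 'Z_n)
    (y z : F) :
  n.-primitive_root y -> n.-primitive_root z ->
  \sum_j y ^+ s j = 0 -> \sum_j z ^+ s j = 0.
Proof.
move=> prim_y prim_z; pose P : {poly rat} := \sum_j 'X^(s j).
have PE x : (map_poly ratr P).[x] = \sum_j x ^+ s j :> F.
  rewrite rmorph_sum horner_sum; apply: eq_bigr => j _.
  by rewrite /= map_polyXn hornerXn.
rewrite -!PE => /rootP Py0; apply/rootP.
exact: root_prim_root_conj prim_y prim_z Py0.
Qed.

(** For even [n], [k |-> (-1) ^+ k] is a character of Z/n, and it changes sign at
    each step; moving the base point of the walk by one step thus negates the
    sum. *)
Lemma sum_walk_N1 (F : numFieldType) (N n : nat) (s : 'Z_N -> 'Z_n) :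
  (1 < n)%N -> ~~ odd n -> cyclic_walk s -> \sum_j (-1) ^+ s j = 0 :> F.
Proof.
move=> n_gt1 even_n walk_s.
have N1n : (-1) ^+ n = 1 :> F by rewrite -signr_odd (negbTE even_n).
have N1D1 (k : 'Z_n) : (-1) ^+ (k + 1)%R = - (-1) ^+ k :> F.
  by rewrite expr_Zp_add // (val_Zp_nat n_gt1 1) modn_small // expr1 mulrN1.
set S := \sum_j _.
have : S = - S.
  rewrite {1}/S (reindex_inj (addIr 1)) -sumrN; apply: eq_bigr => j _.
  case: (walk_s j) => ->; first exact: N1D1.
  by rewrite -{2}(subrK 1 (s j)) N1D1 opprK.
by move/eqP; rewrite -addr_eq0 -mulr2n mulrn_eq0 => /eqP.
Qed.

(** The Fourier transform of the counts [#|occurrences s k|] is the exponential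
    sum along the walk. *)
Lemma occurrences_periodic (F : numFieldType) (N n d : nat) (y : F)
    (s : 'Z_N -> 'Z_n) :
  (1 < n)%N -> n.-primitive_root y ->
  (forall i, (y ^+ i) ^+ d = 1 \/ \sum_j (y ^+ i) ^+ s j = 0) ->
  forall k, #|occurrences s (k + d%:R)| = #|occurrences s k|.
Proof.
move=> n_gt1 prim_y ker_y k; apply/eqP; rewrite -(eqr_nat F); apply/eqP.
move: k; apply: (shift_invariant_of_DFT n_gt1 prim_y) => i.
case: (ker_y i) => [|sum0]; [by left|right].
rewrite -[RHS]sum0 [RHS](partition_big s predT) //=; apply: eq_bigr => k _.
rewrite (eq_bigr (fun=> (y ^+ i) ^+ k)) => [|j /eqP -> //].
by rewrite sumr_const mulr_natl cardsE.
Qed.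

Lemma vanishing_period_prime_power (F : numFieldType) (N p r : nat) (y : F)
    (s : 'Z_N -> 'Z_(p ^ r.+1)) :
  prime p -> (p ^ r.+1).-primitive_root y -> \sum_j y ^+ s j = 0 ->
  forall i, (y ^+ i) ^+ (p ^ r) = 1 \/ \sum_j (y ^+ i) ^+ s j = 0.
Proof.
move=> p_pr prim_y sum0 i; have [/dvdnP[q ->]|ndvd] := boolP (p %| i)%N.
  left; rewrite -exprM -mulnA -expnS mulnC exprM (prim_expr_order prim_y).
  by rewrite expr1n.
right; apply: (sum_walk_conj prim_y _ sum0).
rewrite (prim_root_exp_coprime i prim_y) coprimeXr // coprime_sym.
by rewrite prime_coprime.
Qed.

(** For [i] odd and divisible by [p], the number [y ^+ i] is a square root of
    unity.  At [1] the first alternative holds; at [-1] only the alternation of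
    the parity of [s] makes the sum vanish. *)
Lemma vanishing_period_twice_prime (F : numFieldType) (N p : nat) (y : F)
    (s : 'Z_N -> 'Z_(2 * p)) :
  prime p -> (2 * p).-primitive_root y -> cyclic_walk s ->
  \sum_j y ^+ s j = 0 ->
  forall i, (y ^+ i) ^+ p = 1 \/ \sum_j (y ^+ i) ^+ s j = 0.
Proof.
move=> p_pr prim_y walk_s sum0 i.
have yn1 := prim_expr_order prim_y.
have n_gt1 : (1 < 2 * p)%N by have := prime_gt1 p_pr; lia.
have [/dvdnP[q ->]|odd_i] := boolP (2 %| i)%N.
  by left; rewrite -exprM -mulnA mulnC exprM yn1 expr1n.
have [/dvdnP[q ->]|ndvd] := boolP (p %| i)%N; last first.
  right; apply: (sum_walk_conj prim_y _ sum0).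
  rewrite (prim_root_exp_coprime i prim_y) coprimeMr !(coprime_sym i).
  by rewrite !prime_coprime // odd_i.
have : (y ^+ (q * p)) ^+ 2 == 1.
  by rewrite -exprM -mulnA [(p * 2)%N]mulnC mulnC exprM yn1 expr1n.
rewrite sqrf_eq1 => /orP[/eqP -> | /eqP ->]; first by left; rewrite expr1n.
by right; apply: sum_walk_N1 => //; rewrite oddM.
Qed.

(** * Matching opposite increments *)

Lemma sum_increments_eq0 (R : realType) (N : nat) (phi : 'Z_N -> R[i]) :
  \sum_j increment phi j = 0.
Proof. by rewrite sumrB [X in _ - X](reindex_inj (addIr 1)) subrr. Qed.

(** The [i]-th index with value [k] is matched with the [i]-th index with value
    [h + k]. *)
Lemma involution_of_card_eq (N n : nat) (s : 'Z_N -> 'Z_n) (h : 'Z_n) :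
  h + h = 0 -> (forall k, #|occurrences s (h + k)| = #|occurrences s k|) ->
  exists2 tau : 'Z_N -> 'Z_N, involutive tau & forall j, s (tau j) = h + s j.
Proof.
move=> hh card_h.
pose A k := enum (occurrences s k).
have mem_A k j : (j \in A k) = (s j == k) by rewrite mem_enum inE.
have size_A k : size (A (h + k)) = size (A k) by rewrite -!cardE card_h.
pose tau j := nth j (A (h + s j)) (index j (A (s j))).
have idx_lt j : (index j (A (s j)) < size (A (h + s j)%R))%N.
  by rewrite size_A index_mem mem_A.
have s_tau j : s (tau j) = h + s j.
  by apply/eqP; rewrite -mem_A; apply: mem_nth.
exists tau => // j.
rewrite {1}/tau s_tau addrA hh add0r /tau index_uniq ?enum_uniq //.
by rewrite (set_nth_default j) ?index_mem ?nth_index ?mem_A.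
Qed.

(** * The invariance of the numbers of occurrences *)

(** The period is [n / p] when [n] is a power of the prime [p], and [p] when
    [n = 2 p]; each [n] from [2] to [11] has one of these two forms. *)
Lemma occurrence_period (F : numFieldType) (n : nat) (y : F) :
  (1 < n)%N ->
  (n <= 11)%N
  \/ (exists r : nat, (0 < r)%N /\ n = (2 ^ r)%N)
  \/ (exists p : nat, [/\ prime p, odd p & n = (2 * p)%N]) ->
  n.-primitive_root y ->
  exists d : nat, [/\ (0 < d < n)%N, ~~ odd n -> d = (n %/ 2)%N &
    forall (N : nat) (s : 'Z_N -> 'Z_n), cyclic_walk s ->
      \sum_j y ^+ s j = 0 ->
      forall k, #|occurrences s (k + d%:R)| = #|occurrences s k|].
Proof.
move=> n_gt1 hcase prim_y.
have shape : (exists p r, prime p /\ n = (p ^ r.+1)%N)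
             \/ (exists2 p, prime p & n = (2 * p)%N).
  case: hcase => [n_le|[[[|r] [//] _ ->]|[p [p_pr _ ->]]]].
  - move: n_gt1 n_le {prim_y}; case: n => [|[|n]] // _.
    do 10?[case: n => [|n]] => // _.
    + by left; exists 2, 0.
    + by left; exists 3, 0.
    + by left; exists 2, 1.
    + by left; exists 5, 0.
    + by right; exists 3.
    + by left; exists 7, 0.
    + by left; exists 2, 2.
    + by left; exists 3, 1.
    + by right; exists 5.
    + by left; exists 11, 0.
  - by left; exists 2, r.
  - by right; exists p.
case: shape => [[p [r [p_pr Dn]]]|[p p_pr Dn]]; subst n.
  exists (p ^ r)%N; split=> [||N s walk_s sum0].
  - by rewrite expn_gt0 prime_gt0 //= ltn_exp2l ?prime_gt1.
  - rewrite oddX /= => even_p; suff -> : p = 2 by rewrite expnS mulKn.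
    by case: (even_prime p_pr) => // odd_p; rewrite odd_p in even_p.
  - apply: (occurrences_periodic n_gt1 prim_y).
    exact: vanishing_period_prime_power.
exists p; split=> [||N s walk_s sum0].
- by have := prime_gt0 p_pr; lia.
- by rewrite mulKn.
- apply: (occurrences_periodic n_gt1 prim_y).
  exact: vanishing_period_twice_prime.
Qed.

Theorem proposition12 (R : realType) (m n : nat)
    (hmn : coprime m n) (hm : (1 <= m)%N) (hn : (m < n)%N)
    (hcase : (n <= 11)%N
             \/ (exists r : nat, (0 < r)%N /\ n = (2 ^ r)%N)
             \/ (exists p : nat, [/\ prime p, odd p & n = (2 * p)%N]))
    (N : nat) (hN : (2 <= N)%N)
    (phi : 'Z_N -> R[i]) (s : 'Z_N -> 'Z_n)
    (hphi : is_algebraic_qcs m phi s) :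
  (forall k : 'Z_n, exists j : 'Z_N, s j = k)
  /\ (~~ odd n ->
      (forall k : 'Z_n,
         turn R m n ^+ ((n %/ 2)%:R + k)%R = - turn R m n ^+ k
         /\ #|occurrences s k| = #|occurrences s ((n %/ 2)%:R + k)%R|)
      /\ edges_paired_with_opposites phi).
Proof.
have n_gt1 : (1 < n)%N by apply: leq_ltn_trans hm hn.
have prim_y := turn_prim_root R (ltnW n_gt1) hmn.
set y := turn R m n in prim_y *.
case: hphi => _ [c c_neq0 incr] walk_s; rewrite -/y in incr.
have sum0 : \sum_j y ^+ s j = 0.
  by rewrite -[RHS](sum_increments_eq0 (fun i => c * phi i)); apply: eq_bigr.
have [d [d_bd d_half period]] := occurrence_period n_gt1 hcase prim_y.
have {}period := period N s walk_s sum0.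
split=> [|even_n]; first exact: cyclic_walk_surj n_gt1 d_bd walk_s period.
move: period; rewrite (d_half even_n) => period.
set h : 'Z_n := (n %/ 2)%:R.
have Dn : n = (n %/ 2 * 2)%N by rewrite divnK // dvdn2.
have hh : h + h = 0.
  rewrite /h -natrD addnn -muln2 -Dn; apply/val_inj.
  by rewrite /= val_Zp_nat // modnn.
have yn1 := prim_expr_order prim_y.
have yh : y ^+ h = -1.
  rewrite /h val_Zp_nat // modn_small; last lia.
  have : (y ^+ (n %/ 2)) ^+ 2 == 1 by rewrite -exprM -Dn yn1.
  rewrite sqrf_eq1 -[_ == 1](prim_order_dvd prim_y) => /orP[|/eqP //].
  by move/dvdn_leq; lia.
have opp k : y ^+ (h + k)%R = - y ^+ k by rewrite expr_Zp_add // yh mulN1r.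
have card_h k : #|occurrences s (h + k)| = #|occurrences s k|.
  by rewrite addrC period.
split=> [k|]; first by rewrite card_h.
have [tau tauK s_tau] := involution_of_card_eq hh card_h.
exists tau => // j; apply: (mulfI c_neq0).
have incrE i : c * increment phi i = y ^+ s i by rewrite -incr /increment mulrBr.
by rewrite mulrN !incrE s_tau opp.
Qed.
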